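(* Let $G$ be a group, let $\varphi \in \mathrm{Aut}(G)$, and let $A_\varphi(G)$ denote the generalized Alexander quandle of $G$ with respect to $\varphi$. Then the Cayley graph $\Gamma_{A_\varphi(G)}$ is regular, and both the in-degree and the out-degree of each vertex are equal to the index $[G:H]$ in $G$ of the subgroup $H=\{g\in G : \varphi(g)=g\}$ of fixed points of $\varphi$.
   Context: A quandle is a set $Q$ with a binary operation $\rhd$ such that for all $x,y,z\in Q$: (1) $x\rhd x=x$; (2) for each $y$ the map $R_y(x)=x\rhd y$ is a bijection $Q\to Q$; (3) $(x\rhd y)\rhd z=(x\rhd z)\rhd(y\rhd z)$. For a group $G$ and $\varphi\in\mathrm{Aut}(G)$, the generalized Alexander quandle $A_\varphi(G)$ is the set $G$ with operation $x\rhd y=\varphi(xy^{-1})y$. All graphs are directed graphs, with loops allowed and without multiple edges, so the edge set is a subset of $V\times V$. The (right) Cayley graph $\Gamma_Q$ of a quandle $Q$ is the directed graph with vertex set $Q$ and edge set $\{(x,x\rhd y): x,y\in Q\}$. The out-degree of a vertex $x$ is the number of vertices $z$ such that $(x,z)$ is an edge, and the in-degree of $z$ is the number of vertices $x$ such that $(x,z)$ is an edge (a loop at a vertex counts once in each). A directed graph is regular if all in-degrees and out-degrees of its vertices are equal to one common value. *)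

(* Defs.v *)
From HB Require Import structures.
From mathcomp Require Import all_boot.
From mathcomp Require Import boolp classical_sets functions cardinality.

Set Implicit Arguments.
Unset Strict Implicit.
Unset Printing Implicit Defensive.

Local Open Scope classical_set_scope.
Local Open Scope card_scope.
Local Open Scope group_scope.

Record quandle := Quandle {
  quandle_sort :> Type;
  qop : quandle_sort -> quandle_sort -> quandle_sort;
  qopxx : forall x, qop x x = x;
  qop_bij : forall y, bijective (fun x => qop x y);
  qop_dist : forall x y z, qop (qop x y) z = qop (qop x z) (qop y z)
}.

Notation "x |> y" := (qop x y) (at level 40, left associativity) : group_scope.

(* A directed graph on V, with loops and without multiple edges, is its edge
   set E : set (V * V). *)
Definition cayley_graph (Q : quandle) : set (Q * Q) :=
  [set e | exists x y : Q, e = (x, x |> y)].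
Arguments cayley_graph : clear implicits.

Definition out_neighbours (V : Type) (E : set (V * V)) (x : V) : set V :=
  [set z | E (x, z)].

Definition in_neighbours (V : Type) (E : set (V * V)) (z : V) : set V :=
  [set x | E (x, z)].

(* Degrees are cardinal numbers, possibly infinite: they are compared by
   equipotence (#=) of the neighbourhoods. *)
Definition regular_graph (V : Type) (E : set (V * V)) : Prop :=
  forall u v : V,
    [/\ out_neighbours E u #= out_neighbours E v,
        in_neighbours E u #= in_neighbours E v &
        out_neighbours E u #= in_neighbours E v].

Section AlexanderQuandle.
Variables (G : groupType) (phi : {multiplicative G -> G}).
Hypothesis phi_bij : bijective phi.

Definition alexander_op (x y : G) : G := phi (x * y^-1) * y.

Fact alexander_opxx x : alexander_op x x = x.
Proof.
have phi1 : phi 1 = 1 by apply: (@mulgI _ (phi 1)); rewrite -gmulfM !mulg1.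
by rewrite /alexander_op mulgV phi1 mul1g.
Qed.

Fact alexander_op_bij y : bijective (fun x => alexander_op x y).
Proof.
have [psi phiK psiK] := phi_bij.
by exists (fun z => psi (z * y^-1) * y) => x;
  rewrite /alexander_op mulgK ?phiK ?psiK mulgVK.
Qed.

Fact alexander_op_dist x y z :
  alexander_op (alexander_op x y) z =
  alexander_op (alexander_op x z) (alexander_op y z).
Proof.
have phi1 : phi 1 = 1 by apply: (@mulgI _ (phi 1)); rewrite -gmulfM !mulg1.
have phiV t : phi t^-1 = (phi t)^-1.
  by apply: (@mulgI _ (phi t)); rewrite -gmulfM !mulgV phi1.
by rewrite /alexander_op !(gmulfM, phiV, invgM, invgK, mulgA, mulgVK, mulgK).
Qed.

Definition alexander_quandle : quandle :=
  Quandle alexander_opxx alexander_op_bij alexander_op_dist.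

End AlexanderQuandle.

Definition fixed_points (G : groupType) (phi : {multiplicative G -> G}) :
  {pred G} := [pred g | phi g == g].

Section FixedPointsSubgroup.
Variables (G : groupType) (phi : {multiplicative G -> G}).

Fact fixed_points1 : 1 \in fixed_points phi.
Proof.
by apply/eqP; apply: (@mulgI _ (phi 1)); rewrite -gmulfM !mulg1.
Qed.

Fact fixed_pointsM : {in fixed_points phi &, forall u v,
  u * v \in fixed_points phi}.
Proof. by move=> u v /eqP hu /eqP hv; apply/eqP; rewrite gmulfM hu hv. Qed.

Fact fixed_pointsV : {in fixed_points phi, forall u, u^-1 \in fixed_points phi}.
Proof.
move=> u /eqP hu; apply/eqP/(@mulgI _ u).
by rewrite -[X in X * phi _]hu -gmulfM mulgV (eqP fixed_points1).
Qed.

HB.instance Definition _ := isMulClosed.Build G (fixed_points phi) fixed_pointsM.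
HB.instance Definition _ := isMul1Closed.Build G (fixed_points phi) fixed_points1.
HB.instance Definition _ := isInvClosed.Build G (fixed_points phi) fixed_pointsV.

End FixedPointsSubgroup.

(* The index [G : H] is the cardinal of this set. *)
Definition left_cosets (G : groupType) (H : groupClosed G) : set (set G) :=
  [set C | exists g : G, C = [set g * h | h in [set` H]]].

(* Main.v *)
(* Substituting t = x y^-1 turns x |> y into (phi(t) t^-1) x.  Hence, with
   D = {phi(t) t^-1 : t in G}, the out-neighbourhood of x is D x and the
   in-neighbourhood of x is D^-1 x, both in bijection with D.  Finally
   phi(s) s^-1 = phi(t) t^-1 iff s^-1 t is fixed by phi, so D is in bijection
   with the left cosets of H. *)
Require Import Defs.
From mathcomp Require Import all_boot.
From mathcomp Require Import boolp classical_sets functions cardinality.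

Local Open Scope classical_set_scope.
Local Open Scope card_scope.
Local Open Scope group_scope.

(** Because [f] and [g] have the same fibres, [f t] determines [g t] and conversely, so sending
    [f t] to [g t] is a bijection between the ranges. *)
Lemma card_range_same_fibres (T : choiceType) (U V : Type) (t0 : T)
    (f : T -> U) (g : T -> V) :
  (forall s t, f s = f t <-> g s = g t) -> range f #= range g.
Proof.
move=> fg.
(* Choose a preimage under [f], then apply [g]; the default [t0] is returned only outside the range
   of [f]. *)
pose h u := g (xget t0 [set t | f t = u]).
have hf t : h (f t) = g t.
  by apply/fg; apply: (@xgetPex _ t0 [set s | f s = f t]); exists t.
have -> : range g = h @` range f.
  by rewrite image_comp; apply: eq_imagel => t _ /=; rewrite hf.
rewrite card_eq_sym; apply: inj_card_eq => _ _ /set_mem[s _ <-] /set_mem[t _ <-].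
by rewrite !hf => /fg.
Qed.

Lemma left_cosetsE (G : groupType) (H : groupClosed G) :
  left_cosets H = range (fun g : G => [set g * h | h in [set` H]]).
Proof. by apply/seteqP; split=> [_ [g ->]|_ [g _ <-]]; exists g. Qed.

Lemma left_coset_eqP (G : groupType) (H : groupClosed G) (s t : G) :
  [set s * h | h in [set` H]] = [set t * h | h in [set` H]] <->
  s^-1 * t \in H.
Proof.
split=> [st|Hst].
  (* Since [t] lies in its own coset, it also lies in that of [s]: [t = s * h] gives
     [s^-1 * t = h]. *)
  have : [set t * h | h in [set` H]] t by exists 1; rewrite ?mulg1 //= gpred1.
  by rewrite -st => -[h Hh <-]; rewrite mulKg.
apply/seteqP; split=> _ [h Hh <-].
  exists ((s^-1 * t)^-1 * h) => /=; first by rewrite gpredM ?gpredV.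
  by rewrite invgM invgK !mulgA mulgV mul1g.
exists (s^-1 * t * h) => /=; first exact: gpredM.
by rewrite -mulgA mulVKg.
Qed.

Section AlexanderDegrees.
Variables (G : groupType) (phi : {multiplicative G -> G}).
Hypothesis phi_bij : bijective phi.

Let Gamma := cayley_graph (alexander_quandle phi_bij).

Definition displacement (t : G) : G := phi t * t^-1.

(** Rearranging [phi s * s^-1 = phi t * t^-1] gives [(phi s)^-1 * phi t = s^-1 * t], whose left side
    is [phi (s^-1 * t)]. *)
Lemma displacement_eqP (s t : G) :
  displacement s = displacement t <-> s^-1 * t \in fixed_points phi.
Proof.
have phiV : phi s^-1 = (phi s)^-1.
  apply: (@mulgI _ (phi s)); rewrite -gmulfM !mulgV.
  exact/eqP/(fixed_points1 phi).
rewrite inE gmulfM phiV /displacement; split=> [st|/eqP st].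
  by rewrite -[phi t](mulgVK t) -st !mulgA mulVg mul1g.
by apply: (@mulIg _ t); rewrite -mulgA -st mulgVK mulVKg.
Qed.

Lemma alexander_edgeE (x z : G) :
  Gamma (x, z) <-> exists t, z = displacement t * x.
Proof.
split=> [[_ [y [<- ->]]]|[t ->]].
  by exists (x * y^-1); rewrite /displacement invgM invgK -!mulgA mulVg mulg1.
(* The second witness is the solution [y] of [x * y^-1 = t]. *)
exists x, (t^-1 * x); congr pair.
by rewrite /= /alexander_op invgM invgK mulVKg mulgA.
Qed.

Lemma card_out_neighbours (x : G) :
  out_neighbours Gamma x #= left_cosets (fixed_points phi).
Proof.
have -> : out_neighbours Gamma x = range (fun t => displacement t * x).
  apply/seteqP; split=> [z /alexander_edgeE[t ->]|_ [t _ <-]]; first by exists t.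
  by apply/alexander_edgeE; exists t.
rewrite left_cosetsE; apply: (card_range_same_fibres _ _ _ 1 _ _) => s t.
rewrite left_coset_eqP -displacement_eqP.
(* Right translation by [x] is injective, so it leaves the fibres of [displacement] unchanged. *)
by split=> [/mulIg|->].
Qed.

Lemma card_in_neighbours (z : G) :
  in_neighbours Gamma z #= left_cosets (fixed_points phi).
Proof.
have -> : in_neighbours Gamma z = range (fun t => (displacement t)^-1 * z).
  apply/seteqP; split=> [x /alexander_edgeE[t ->]|_ [t _ <-]].
    by exists t => //; rewrite mulKg.
  by apply/alexander_edgeE; exists t; rewrite mulVKg.
rewrite left_cosetsE; apply: (card_range_same_fibres _ _ _ 1 _ _) => s t.
rewrite left_coset_eqP -displacement_eqP.
(* Inversion followed by right translation is injective as well, so the fibres are again those of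
   [displacement]. *)
by split=> [/mulIg/invg_inj|->].
Qed.

End AlexanderDegrees.

Theorem theorem4p2 (G : groupType) (phi : {multiplicative G -> G})
    (phi_bij : bijective phi) :
  let A := alexander_quandle phi_bij in
  let Gamma := cayley_graph A in
  let index := left_cosets (fixed_points phi) in
  [/\ regular_graph Gamma,
      forall x : A, in_neighbours Gamma x #= index &
      forall x : A, out_neighbours Gamma x #= index].
Proof.
move=> A Gamma index.
have cin (x : A) : in_neighbours Gamma x #= index by exact: card_in_neighbours.
have cout (x : A) : out_neighbours Gamma x #= index.
  exact: card_out_neighbours.
(* Each of the three equipotences for regularity is obtained by passing through [index]. *)
split=> // u v; split.
- by rewrite (card_eql (cout u)) card_eq_sym.
- by rewrite (card_eql (cin u)) card_eq_sym.
- by rewrite (card_eql (cout u)) card_eq_sym.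
Qed.
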